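(* Let $3\le\alpha<\omega$. In every equational axiom set for $Pse_\alpha$ there is a set $\{e_n\}_{n<\omega}$ of axioms such that, for each $n<\omega$, more than $n$ distinct algebraic variables occur in $e_n$ together with some transposition $p_{ij}$, some diagonal constant $d_{kl}$ and some cylindrification $c_m$.
   Context: A polyadic equality set algebra of dimension $\alpha$ with base set $U$ is an algebra $\langle A,+,-,C^U_i,D^U_{ij},P_{ij}\rangle_{i,j<\alpha}$, where $A$ is a set of subsets of $U^\alpha$ containing the $D^U_{ij}$ and closed under the operations: $+$ is union, $-$ is complement with respect to $U^\alpha$, $C^U_i(X)=\{u\in U^\alpha : \text{there is } u'\in X \text{ with } u_j=u'_j \text{ for all } j\neq i\}$, $D^U_{ij}=\{u\in U^\alpha : u_i=u_j\}$, and $P_{ij}(X)=\{u\in U^\alpha : \text{there is } u'\in X \text{ with } u_i=u'_j,\ u_j=u'_i,\ u_l=u'_l \text{ for all } l\notin\{i,j\}\}$. $Pse_\alpha$ is the class of all polyadic equality set algebras of dimension $\alpha$. The formal language has operation symbols $+$ (binary), $-,c_i,p_{ij}$ (unary), $d_{ij}$ (constants), $i,j<\alpha$, where in a polyadic equality set algebra with base set $U$ the symbol $+$ is interpreted as union, $-$ as complement with respect to $U^\alpha$, $c_i$ as $C^U_i$, $p_{ij}$ as $P_{ij}$, and $d_{ij}$ as $D^U_{ij}$; the $c_i$ are cylindrifications, the $d_{ij}$ diagonal constants, the $p_{ij}$ transpositions. An equational axiom set for $Pse_\alpha$ is a set of equations true in $Pse_\alpha$ from which all equations true in $Pse_\alpha$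 are derivable. *)

(* Defs.v *)
From mathcomp Require Import all_boot.
From mathcomp Require Import classical_sets.

Set Implicit Arguments.
Unset Strict Implicit.
Unset Printing Implicit Defensive.

Local Open Scope classical_set_scope.

Section Language.
Variable alpha : nat.

(* The algebraic variables are indexed by [nat]. *)
Inductive term : Type :=
| Var of nat
| Plus of term & term
| Minus of term
| Cyl of 'I_alpha & term
| Transp of 'I_alpha & 'I_alpha & term
| Diag of 'I_alpha & 'I_alpha.

Definition equation : Type := (term * term)%type.

Inductive symbol : Type :=
| SPlus
| SMinus
| SCyl of 'I_alpha
| STransp of 'I_alpha & 'I_alpha
| SDiag of 'I_alpha & 'I_alpha.

Fixpoint occurs_term (f : symbol) (t : term) : Prop :=
  match t with
  | Var _ => False
  | Plus s t => [\/ f = SPlus, occurs_term f s | occurs_term f t]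
  | Minus t => f = SMinus \/ occurs_term f t
  | Cyl i t => f = SCyl i \/ occurs_term f t
  | Transp i j t => f = STransp i j \/ occurs_term f t
  | Diag i j => f = SDiag i j
  end.

Definition occurs (f : symbol) (e : equation) : Prop :=
  occurs_term f e.1 \/ occurs_term f e.2.

Fixpoint vars_term (t : term) : seq nat :=
  match t with
  | Var x => [:: x]
  | Plus s t => vars_term s ++ vars_term t
  | Minus t | Cyl _ t | Transp _ _ t => vars_term t
  | Diag _ _ => [::]
  end.

Definition vars (e : equation) : seq nat :=
  undup (vars_term e.1 ++ vars_term e.2).

Fixpoint subst (sigma : nat -> term) (t : term) : term :=
  match t with
  | Var x => sigma x
  | Plus s t => Plus (subst sigma s) (subst sigma t)
  | Minus t => Minus (subst sigma t)
  | Cyl i t => Cyl i (subst sigma t)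
  | Transp i j t => Transp i j (subst sigma t)
  | Diag i j => Diag i j
  end.

(* Birkhoff's calculus of equational logic. *)
Inductive derivable (E : set equation) : term -> term -> Prop :=
| derivable_ax s t : E (s, t) -> derivable E s t
| derivable_refl t : derivable E t t
| derivable_sym s t : derivable E s t -> derivable E t s
| derivable_trans s t u :
    derivable E s t -> derivable E t u -> derivable E s u
| derivable_subst sigma s t :
    derivable E s t -> derivable E (subst sigma s) (subst sigma t)
| derivable_plus s s' t t' :
    derivable E s s' -> derivable E t t' ->
    derivable E (Plus s t) (Plus s' t')
| derivable_minus t t' :
    derivable E t t' -> derivable E (Minus t) (Minus t')
| derivable_cyl i t t' :
    derivable E t t' -> derivable E (Cyl i t) (Cyl i t')
| derivable_transp i j t t' :
    derivable E t t' -> derivable E (Transp i j t) (Transp i j t').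

End Language.

Section SetAlgebras.
Variables (alpha : nat) (U : Type).

Definition cylinder (i : 'I_alpha) (X : set ('I_alpha -> U)) :
    set ('I_alpha -> U) :=
  [set u | exists2 u', X u' & forall j, j <> i -> u j = u' j].

Definition diagonal (i j : 'I_alpha) : set ('I_alpha -> U) :=
  [set u | u i = u j].

Definition transposition (i j : 'I_alpha) (X : set ('I_alpha -> U)) :
    set ('I_alpha -> U) :=
  [set u | exists2 u', X u' &
    [/\ u i = u' j, u j = u' i &
        forall l, l <> i -> l <> j -> u l = u' l]].

End SetAlgebras.

Record pse (alpha : nat) := Pse {
  base : Type;
  carrier : set (set ('I_alpha -> base));
  carrier_diag : forall i j, carrier (diagonal i j);
  carrier_plus : forall X Y, carrier X -> carrier Y -> carrier (X `|` Y);
  carrier_minus : forall X, carrier X -> carrier (~` X);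
  carrier_cyl : forall i X, carrier X -> carrier (cylinder i X);
  carrier_transp : forall i j X, carrier X -> carrier (transposition i j X)
}.

Section Truth.
Variable alpha : nat.

Fixpoint eval (U : Type) (v : nat -> set ('I_alpha -> U)) (t : term alpha) :
    set ('I_alpha -> U) :=
  match t with
  | Var x => v x
  | Plus s t => eval v s `|` eval v t
  | Minus t => ~` eval v t
  | Cyl i t => cylinder i (eval v t)
  | Transp i j t => transposition i j (eval v t)
  | Diag i j => diagonal i j
  end.

(* The operations of [A] are those of the full set algebra restricted to
   [carrier A], so [eval] may be used with valuations into [carrier A]. *)
Definition true_in (A : pse alpha) (e : equation alpha) : Prop :=
  forall v : nat -> set ('I_alpha -> base A),
    (forall x, carrier (v x)) -> eval v e.1 = eval v e.2.

Definition true_in_Pse (e : equation alpha) : Prop :=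
  forall A : pse alpha, true_in A e.

Definition equational_axiom_set (E : set (equation alpha)) : Prop :=
  (forall e, E e -> true_in_Pse e) /\
  (forall e, true_in_Pse e -> derivable E e.1 e.2).

End Truth.

(* Main.v *)
Require Import Defs.
From mathcomp Require Import all_boot.
From mathcomp Require Import fingroup perm ssralg zmodp zify.
From mathcomp Require Import boolp.
From mathcomp Require Import classical_sets.

Set Implicit Arguments.
Unset Strict Implicit.
Unset Printing Implicit Defensive.

Local Open Scope classical_set_scope.

(** For each n there is an algebra that is not in the variety generated by the
set algebras, although it satisfies every true equation that has at most n
variables, or no transposition, or no diagonal constant, or no
cylindrification.  Some axiom must fail in it, and that axiom has all four
properties.

The algebra arises by splitting.  Let m = 2k + 3 and let the base consist of a
set V of m vertices, of all the enumerations of V, and of auxiliary fillers of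
a different sort for each coordinate c.  Let G be the group that permutes V
(and moves the enumerations accordingly) and, independently, the fillers of
each sort.  Let R be the set of the tuples (x, y, z_2, z_3, ...) with x <> y
in V and z_c a filler of sort c.  It is a single G-orbit, invariant under the
transposition p_01.  In the algebra of G-invariant relations, R and each of its
coordinate permutations is formally split into m - 1 pieces R_j such that
c_i R_j = c_i R for all i and p_01 R_j = R_j.  This is done with a frame
([split_frame]) whose points are pairs of a tuple and a block j, and with the
sets of points that respect the equivalence [orbit_equiv eq].

No set algebra allows such a splitting: for fixed z the pieces would be m - 1
disjoint symmetric irreflexive relations on V, each total on V, hence m - 1
perfect matchings of a set of odd size m
([no_odd_matching_decomposition]).  The enumerations of V express that V has
at most m elements.  The resulting inconsistent set of inclusions turns into an
equation ([matching_equation]), because c_0 c_1 ... of a nonempty relation is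
everything in a set algebra.

On the other hand, a surjection from the tuples over some set to the frame that
commutes with the operations occurring in a true equation transfers the
equation to the frame ([sem_eq_of_representation]).  Such maps exist as soon as
the splitting is realised with respect to fewer operations or with fewer
pieces, and they are given by labels, the label of a tuple in R being the index
of its piece:
- without transpositions, (y - x) - 1 plus the sum of the fillers, modulo
  m - 1: the pieces are then permutation graphs instead of matchings;
- without diagonal constants, the base points are cloned, each clone carries an
  index, and the label is the sum of the indices, so that the size of V is no
  obstacle;
- without cylindrifications, the sum of the fillers alone;
- for n variables, the values of the variables tell only few blocks apart, so
  that blocks may be merged until at most k + 1 remain; k + 1 pieces can be
  realised symmetrically, by (y - x) - 1 or (x - y) - 1, whichever is at most
  k, plus the sum of the fillers modulo k + 1. *)

(** * Complex algebras of frames *)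

(** Relational structures whose complex algebras have the type of polyadic
equality algebras.  The transpositions come from functions, since they are
Boolean automorphisms in the algebras under consideration. *)
Record frame (alpha : nat) := Frame {
  point :> Type;
  access : 'I_alpha -> point -> point -> Prop;
  exchange : 'I_alpha -> 'I_alpha -> point -> point;
  diag : 'I_alpha -> 'I_alpha -> point -> Prop
}.

Section Frames.
Variable alpha : nat.
Implicit Types (M : frame alpha) (s t : term alpha) (e : equation alpha).
Implicit Types (E : set (equation alpha)) (f : symbol alpha).

Fixpoint sem M (v : nat -> set M) t : set M :=
  match t with
  | Var x => v x
  | Plus s t => sem v s `|` sem v t
  | Minus t => ~` sem v t
  | Cyl i t => [set m | exists2 m', sem v t m' & access i m m']
  | Transp i j t => [set m | sem v t (exchange i j m)]
  | Diag i j => [set m | diag i j m]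
  end.

Definition permute (U : Type) (i j : 'I_alpha) (u : 'I_alpha -> U) :=
  fun l => u (tperm i j l).

Definition set_frame (U : Type) : frame alpha :=
  @Frame alpha ('I_alpha -> U)
    (fun i u u' => forall l, l <> i -> u l = u' l)
    (@permute U) (fun i j u => u i = u j).

Lemma transpositionE (U : Type) i j (X : set ('I_alpha -> U)) :
  transposition i j X = [set u | X (permute i j u)].
Proof.
apply/seteqP; split => [u [u' Xu' [uij uji ul]] | u Xu] /=.
  suff -> : permute i j u = u' by [].
  apply/funext => l; rewrite /permute.
  by case: tpermP => [->|->|/ul H /H].
exists (permute i j u) => //; rewrite /permute; split => [||l li lj].
- by rewrite tpermR.
- by rewrite tpermL.
- by rewrite tpermD //; apply/eqP => /esym.
Qed.

Lemma eval_sem (U : Type) (v : nat -> set ('I_alpha -> U)) t :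
  eval v t = sem (M := set_frame U) v t.
Proof.
elim: t => [x|s IHs t IHt|t IHt|i t IHt|i j t IHt|i j] //=.
- by rewrite IHs IHt.
- by rewrite IHt.
- by rewrite IHt.
- by rewrite transpositionE IHt.
Qed.

Definition full_pse (U : Type) : pse alpha :=
  @Pse alpha U setT (fun _ _ => I) (fun _ _ _ _ => I) (fun _ _ => I)
    (fun _ _ _ => I) (fun _ _ _ _ => I).

Lemma true_in_Pse_set_frame e : true_in_Pse e ->
  forall (U : Type) (v : nat -> set (set_frame U)), sem v e.1 = sem v e.2.
Proof.
move=> He U v; have := He (full_pse U) v (fun=> I).
by rewrite !eval_sem.
Qed.

Section Quotient.
Variables (M : frame alpha) (eqv : M -> M -> Prop).

(** The algebra under study consists of the saturated sets; using it instead of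
a quotient frame avoids choosing representatives of the classes. *)
Definition saturated (X : set M) := forall m m', eqv m m' -> X m -> X m'.

Record congruence : Prop := Congruence {
  congr_sym : forall m m', eqv m m' -> eqv m' m;
  congr_access : forall i m m' n, eqv m m' -> access i m n -> access i m' n;
  congr_exchange : forall i j m m',
    eqv m m' -> eqv (exchange i j m) (exchange i j m');
  congr_diag : forall i j m m', eqv m m' -> diag i j m -> diag i j m'
}.

Hypothesis eqvC : congruence.

Lemma sem_saturated (v : nat -> set M) t :
  (forall x, x \in vars_term t -> saturated (v x)) -> saturated (sem v t).
Proof.
elim: t => [x|s IHs t IHt|t IHt|i t IHt|i j t IHt|i j] /= vsat m m' mm'.
- by apply: vsat mm'; rewrite mem_head.
- case=> [sm|tm]; [left|right].
    by apply: IHs mm' sm => x xs; apply: vsat; rewrite mem_cat xs.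
  by apply: IHt mm' tm => x xt; apply: vsat; rewrite mem_cat xt orbT.
- by move=> nt tm'; apply: nt; apply: IHt tm' => //; exact: congr_sym.
- by case=> n tn mn; exists n => //; exact: congr_access mn.
- by apply: IHt => //; exact: congr_exchange.
- exact: congr_diag.
Qed.

Lemma sem_subst (v : nat -> set M) sigma t :
  sem v (subst sigma t) = sem (fun x => sem v (sigma x)) t.
Proof.
by elim: t => [x|s IHs t IHt|t IHt|i t IHt|i j t IHt|i j] //=;
  rewrite ?IHs IHt.
Qed.

Definition valid e :=
  forall v : nat -> set M,
    (forall x, x \in vars e -> saturated (v x)) -> sem v e.1 = sem v e.2.

(** Soundness of equational logic for the algebra of the saturated sets. *)
Lemma derivable_sound E : (forall e, E e -> valid e) ->
  forall s t, derivable E s t ->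
  forall v : nat -> set M, (forall x, saturated (v x)) -> sem v s = sem v t.
Proof.
move=> Evalid s t; elim => {s t} //=.
- by move=> s t /Evalid st v vsat; apply: st.
- by move=> s t _ IH v /IH ->.
- by move=> s t u _ IHst _ IHtu v vsat; rewrite IHst ?IHtu.
- move=> sigma s t _ IH v vsat; rewrite !sem_subst; apply: IH => x.
  by apply: sem_saturated => y _; exact: vsat.
- by move=> s s' t t' _ IHs _ IHt v vsat; rewrite IHs ?IHt.
- by move=> t t' _ IH v vsat; rewrite IH.
- by move=> i t t' _ IH v vsat; rewrite IH.
- by move=> i j t t' _ IH v vsat; rewrite IH.
Qed.

Section Representation.
Variables (U : Type) (h : set_frame U -> M).

(** The part of being a bounded morphism modulo [eqv] that concerns one
operation. *)
Definition respects f : Prop :=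
  match f with
  | SPlus | SMinus => True
  | SCyl i =>
      (forall u u', access i u u' -> access i (h u) (h u')) /\
      (forall u m, access i (h u) m ->
         exists2 u', access i u u' & eqv (h u') m)
  | STransp i j => forall u, eqv (h (exchange i j u)) (exchange i j (h u))
  | SDiag i j => forall u, diag i j (h u) <-> u i = u j
  end.

(** Inverse image along [h] is a homomorphism for the operations that [h]
respects, which need not be all of them. *)
Lemma sem_pullback (v : nat -> set M) t :
  (forall x, x \in vars_term t -> saturated (v x)) ->
  (forall f, occurs_term f t -> respects f) ->
  forall u, sem v t (h u) <-> sem (fun x => h @^-1` v x) t u.
Proof.
elim: t => [x|s IHs t IHt|t IHt|i t IHt|i j t IHt|i j] //= vsat hf u.
- have IHs' u' : sem v s (h u') <-> sem (fun x => h @^-1` v x) s u'.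
    apply: IHs => [x xs|f fs]; first by apply: vsat; rewrite mem_cat xs.
    by apply: hf; apply: Or32.
  have IHt' u' : sem v t (h u') <-> sem (fun x => h @^-1` v x) t u'.
    apply: IHt => [x xt|f ft]; first by apply: vsat; rewrite mem_cat xt orbT.
    by apply: hf; apply: Or33.
  by split=> -[/IHs'|/IHt'] ?; [left|right|left|right].
- have IHt' u' : sem v t (h u') <-> sem (fun x => h @^-1` v x) t u'.
    by apply: IHt => // f ft; apply: hf; right.
  by split=> nt /IHt'.
- have IHt' u' : sem v t (h u') <-> sem (fun x => h @^-1` v x) t u'.
    by apply: IHt => // f ft; apply: hf; right.
  have [hforth hback] : respects (SCyl i) by apply: hf; left.
  split=> [[m tm /hback [u' uu' u'm]] | [u' /IHt' tu' /hforth uu']].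
    exists u' => //; apply/IHt'; move: tm; apply: sem_saturated => //.
    exact: congr_sym.
  by exists (h u').
- have IHt' u' : sem v t (h u') <-> sem (fun x => h @^-1` v x) t u'.
    by apply: IHt => // f ft; apply: hf; right.
  have hperm : respects (STransp i j) by apply: hf; left.
  have tsat := sem_saturated vsat.
  split=> [tu | /IHt']; last exact: (tsat _ _ (hperm u)).
  by apply/IHt'; exact: (tsat _ _ (congr_sym eqvC (hperm u))).
- by have := hf (SDiag i j) erefl; apply.
Qed.

(** Since [h] meets every class, inverse image is moreover injective on
saturated sets, so that an equality in the full set algebra reflects to the
frame.  The valuation is fixed, as [eqv] may have to depend on it. *)
Lemma sem_eq_of_representation e (v : nat -> set M) : true_in_Pse e ->
  (forall m, exists u, eqv (h u) m) ->
  (forall f, occurs f e -> respects f) ->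
  (forall x, x \in vars e -> saturated (v x)) -> sem v e.1 = sem v e.2.
Proof.
move=> etrue honto hf vsat.
have vsat1 x : x \in vars_term e.1 -> saturated (v x).
  by move=> xe; apply: vsat; rewrite mem_undup mem_cat xe.
have vsat2 x : x \in vars_term e.2 -> saturated (v x).
  by move=> xe; apply: vsat; rewrite mem_undup mem_cat xe orbT.
have hf1 f : occurs_term f e.1 -> respects f by move=> fe; apply: hf; left.
have hf2 f : occurs_term f e.2 -> respects f by move=> fe; apply: hf; right.
have eq12 u : sem v e.1 (h u) <-> sem v e.2 (h u).
  by rewrite !sem_pullback // (true_in_Pse_set_frame etrue).
have sat1 := sem_saturated vsat1; have sat2 := sem_saturated vsat2.
apply/seteqP; split=> m; have [u um] := honto m.
  by move/(sat1 _ _ (congr_sym eqvC um)) => /eq12; exact: sat2.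
by move/(sat2 _ _ (congr_sym eqvC um)) => /eq12; exact: sat1.
Qed.

End Representation.
End Quotient.
End Frames.

(** * Equations that express quasi-identities *)

Section Encoding.
Variable a : nat.
Notation coord := 'I_a.+3.
Implicit Types (s t g : term a.+3) (M : frame a.+3).

Definition pos0 : coord := Ordinal (isT : 0 < a.+3).
Definition pos1 : coord := Ordinal (isT : 1 < a.+3).
Definition pos2 : coord := Ordinal (isT : 2 < a.+3).

Definition meet s t := Minus (Plus (Minus s) (Minus t)).
Definition zero : term a.+3 := meet (Diag pos0 pos0) (Minus (Diag pos0 pos0)).
Arguments meet : simpl never.
Arguments zero : simpl never.
Definition join_all (ts : seq (term a.+3)) := foldr (@Plus a.+3) zero ts.
Definition exist_all t := foldr (@Cyl a.+3) t (enum coord).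

Definition cylindrify M i (X : set M) : set M :=
  [set m | exists2 m', X m' & access i m m'].

(** [g] is below the full cylindrification of the union of the violations of
the inclusions [hyps].  In a set algebra that cylindrification is everything
when some inclusion is violated; hence the equation says that [g] is empty
whenever [hyps] hold. *)
Definition quasi_equation (hyps : seq (equation a.+3)) g : equation a.+3 :=
  (meet g (Minus (exist_all (join_all [seq meet h.1 (Minus h.2) | h <- hyps]))),
   zero).

Section Semantics.
Variables (M : frame a.+3) (v : nat -> set M).

Lemma sem_meet s t m : sem v (meet s t) m <-> sem v s m /\ sem v t m.
Proof.
rewrite /meet; split=> [/= /not_orP[/contrapT sm /contrapT tm] // | [sm tm] /=].
by case; apply.
Qed.

Lemma sem_cyl i t : sem v (Cyl i t) = cylindrify i (sem v t).
Proof. by []. Qed.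

Lemma sem_minus t m : sem v (Minus t) m = (~ sem v t m).
Proof. by []. Qed.

Lemma sem_zero m : ~ sem v zero m.
Proof. by move=> /sem_meet []. Qed.

Lemma sem_join_all ts m :
  sem v (join_all ts) m <-> exists2 i, i < size ts & sem v (nth zero ts i) m.
Proof.
elim: ts => [|t ts IH] /=.
  by split=> [/sem_zero//|[]].
split=> [[tm|/IH[i]] | [[|i] /= lti]].
- by exists 0.
- by exists i.+1.
- by left.
- by move=> im; right; apply/IH; exists i.
Qed.

Definition models (h : equation a.+3) := `[< sem v h.1 `<=` sem v h.2 >].

Lemma violation_empty (hyps : seq (equation a.+3)) :
  (forall m, ~ sem v (join_all [seq meet h.1 (Minus h.2) | h <- hyps]) m) <->
  all models hyps.
Proof.
elim: hyps => [|h hyps IH]; first by split=> // _ m /sem_zero.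
rewrite [all _ _]/=; split=> [noviol | /andP[/asboolP hh /IH noviol] m].
  apply/andP; split; last by apply/IH => m vm; apply: (noviol m); right.
  apply/asboolP => m hm; apply: contrapT => nhm; apply: (noviol m); left.
  exact/sem_meet.
have violE : sem v (join_all [seq meet h.1 (Minus h.2) | h <- h :: hyps]) m <->
    sem v (meet h.1 (Minus h.2)) m \/
    sem v (join_all [seq meet h.1 (Minus h.2) | h <- hyps]) m by [].
by move/violE => -[/sem_meet[/hh hm nhm]|/noviol//]; exact: nhm.
Qed.

Lemma exist_all_empty t : (forall m, ~ sem v t m) ->
  forall m, ~ sem v (exist_all t) m.
Proof.
rewrite /exist_all => nt; elim: (enum _) => //= i l IH m [m' /IH].
by [].
Qed.

(** Only the normality of the operators enters here, so that this direction
holds in all frames. *)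
Lemma quasi_equation_refuted hyps g m : all models hyps -> sem v g m ->
  sem v (quasi_equation hyps g).1 <> sem v (quasi_equation hyps g).2.
Proof.
move=> /violation_empty/exist_all_empty noviol gm /seteqP[sub _].
by apply: (@sem_zero m); apply: sub; apply/sem_meet; split; [|exact: noviol].
Qed.

End Semantics.

(** Any tuple can be changed into any other one coordinate at a time. *)
Lemma exist_all_set_frame (U : Type) (v : nat -> set (set_frame a.+3 U)) t u :
  sem v t u -> forall u', sem v (exist_all t) u'.
Proof.
rewrite /exist_all => tu u'.
suff ind l w : (forall i, i \notin l -> w i = u i) ->
    sem v (foldr (@Cyl a.+3) t l) w.
  by apply: ind => i; rewrite mem_enum.
elim: l w => [|i l IH] w wu /=.
  by have -> : w = u by apply/funext => i; apply: wu.
exists (fun l => if l == i then u i else w l) => [|l' /eqP/negbTE-> //].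
apply: IH => l' l'l; case: eqP => [-> //|/eqP l'i].
by apply: wu; rewrite inE negb_or l'i.
Qed.

Lemma quasi_equation_true hyps g :
  (forall (U : Type) (v : nat -> set (set_frame a.+3 U)),
     all (models v) hyps -> forall u, ~ sem v g u) ->
  true_in_Pse (quasi_equation hyps g).
Proof.
move=> Hhyps A v _; rewrite !eval_sem; apply/seteqP; split=> u; last first.
  by move=> /sem_zero.
case/sem_meet=> gu noviol; exfalso; apply: (Hhyps _ v) gu.
by apply/violation_empty => u' /exist_all_set_frame/(_ u).
Qed.

End Encoding.

(** * Matchings of a finite set of odd size *)

Lemma even_size_involution (T : eqType) (f : T -> T) (s : seq T) : uniq s ->
  {in s, forall x, f x \in s} -> {in s, forall x, f (f x) = x} ->
  {in s, forall x, f x != x} -> ~~ odd (size s).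
Proof.
have [n] := ubnP (size s); elim: n s => // n IH [|x s] //=; rewrite ltnS => szs.
case/andP=> xs us fs ff fx.
have fxs : f x \in s.
  have := fs x (mem_head _ _).
  by rewrite in_cons (negbTE (fx x (mem_head _ _))).
have mem_rest y : y \in rem (f x) s -> [/\ y \in x :: s, y != f x & y != x].
  rewrite (mem_rem_uniq _ us) !inE => /andP[yfx ys].
  by split=> //; [rewrite ys orbT | apply: contraNneq xs => <-].
have szrem : size s = (size (rem (f x) s)).+1.
  rewrite size_rem // prednK // lt0n size_eq0.
  by apply: contraTneq fxs => ->.
rewrite szrem /= negbK; apply: IH; first by rewrite -szrem ltnW.
- exact: rem_uniq.
- move=> y /mem_rest[ys yfx yx]; rewrite (mem_rem_uniq _ us) !inE.
  apply/andP; split.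
    by apply: contraNneq yx => /(congr1 f); rewrite !ff ?mem_head// => ->.
  have := fs y ys; rewrite in_cons => /orP[/eqP fyx|//].
  by move: yfx; rewrite -fyx ff ?eqxx.
- by move=> y /mem_rest[ys _ _]; exact: ff.
- by move=> y /mem_rest[ys _ _]; exact: fx.
Qed.

(** Here [S] is listed by the [q.+1] partial constants [F].  Each point has a
neighbour in each of the [q] disjoint relations [X j], and all these neighbours
differ from each other and from the point; so [S] has exactly [q.+1] points,
and each of them has only one [X 0]-neighbour.  Hence [X 0] is a
fixed-point-free involution of a set of odd size. *)
Lemma no_odd_matching_decomposition (U : Type) (q : nat) (S : U -> Prop)
    (X : nat -> U -> U -> Prop) (F : nat -> U -> Prop) :
  ~~ odd q -> 0 < q -> (exists x, S x) ->
  (forall x, S x -> exists2 i, i < q.+1 & F i x) ->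
  (forall i x y, i < q.+1 -> F i x -> F i y -> x = y) ->
  (forall j x, j < q -> S x -> exists2 y, S y & X j x y) ->
  (forall j x y, j < q -> X j x y -> X j y x) ->
  (forall j x, j < q -> ~ X j x x) ->
  (forall i j x y, i < j -> j < q -> X i x y -> ~ X j x y) -> False.
Proof.
move=> evq q0 [x0 Sx0] SF Finj Xtot Xsym Xirr Xdisj.
pose T : eqType := {classic U}.
have [c cP] : exists c : nat -> option T, forall i, i < q.+1 ->
    (forall x, S x -> F i x -> c i = Some x) /\
    (forall x, c i = Some x -> S x).
  suff: forall i, exists o : option T, i < q.+1 ->
      (forall x, S x -> F i x -> o = Some x) /\ (forall x, o = Some x -> S x).
    by move/choice => [c cP]; exists c.
  move=> i; have [[x [Sx Fx]]|no] := pselect (exists x, S x /\ F i x).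
    exists (Some x) => iq; split=> [y Sy Fy | y [<-] //].
    by rewrite (Finj i x y).
  by exists None => iq; split=> // y Sy Fy; case: no; exists y.
pose s : seq T := undup (pmap c (iota 0 q.+1)).
have us : uniq s by exact: undup_uniq.
have memE x : x \in s <-> S x.
  rewrite mem_undup mem_pmap; split=> [/mapP[i] | Sx].
    by rewrite mem_iota => /= /cP[_ ci] /esym /ci.
  have [i iq Fi] := SF x Sx; apply/mapP; exists i; first by rewrite mem_iota.
  by have [/(_ x Sx Fi) ->] := cP i iq.
have szs : size s <= q.+1.
  rewrite (leq_trans (size_undup _)) // size_pmap.
  rewrite (leq_trans (count_size _ _)) //.
  by rewrite size_iota.
have [nbr nbrP] : exists nbr : nat -> T -> T, forall j x, j < q -> x \in s ->
    nbr j x \in s /\ X j x (nbr j x).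
  have /choice[f fP] (p : nat * T) : exists y : T, p.1 < q -> p.2 \in s ->
      y \in s /\ X p.1 p.2 y.
    case: p => j x /=; have [jq|_] := boolP (j < q); last by exists x.
    have [xs|_] := boolP (x \in s); last by exists x.
    have [y Sy Xy] := Xtot j x jq (iffLR (memE x) xs).
    by exists y => _ _; split=> //; apply/memE.
  by exists (fun j x => f (j, x)) => j x; exact: (fP (j, x)).
have Xeq i j x y : i < q -> j < q -> X i x y -> X j x y -> i = j.
  move=> iq jq Xi Xj; case: (ltngtP i j) => // ij.
    by case: (Xdisj _ _ _ _ ij jq Xi Xj).
  by case: (Xdisj _ _ _ _ ij iq Xj Xi).
(* The neighbours of [x] exhaust the other points. *)
have allnbr x : x \in s ->
    (size s = q.+1) /\ (forall y, y \in s -> y != x ->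
       exists2 j, j < q & y = nbr j x).
  move=> xs; pose l := [seq nbr j x | j <- iota 0 q].
  have ul : uniq l.
    rewrite map_inj_in_uniq ?iota_uniq // => i j.
    rewrite !mem_iota /= => iq jq ij.
    apply: (Xeq i j x (nbr i x)) => //; first by have [] := nbrP i x iq xs.
    by rewrite ij; have [] := nbrP j x jq xs.
  have lsub : {subset l <= rem x s}.
    move=> y /mapP[j]; rewrite mem_iota /= => jq ->.
    have [ns Xn] := nbrP j x jq xs; rewrite mem_rem_uniq // inE ns andbT.
    by apply/eqP => nx; apply: (Xirr j x jq); rewrite nx in Xn.
  have s0 : 0 < size s by case: (s) xs.
  have szl : size l = q by rewrite size_map size_iota.
  have [szE memlE] : (size l = size (rem x s)) * (l =i rem x s).
    by apply: uniq_min_size => //; rewrite szl size_rem // -ltnS prednK.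
  split; first by move: szE; rewrite szl size_rem // => ->; rewrite prednK.
  move=> y ys yx; have : y \in l by rewrite memlE mem_rem_uniq // inE yx ys.
  by move=> /mapP[j]; rewrite mem_iota => /= jq ->; exists j.
have [szE _] := allnbr x0 (iffRL (memE x0) Sx0).
suff : ~~ odd (size s) by rewrite szE /= negbK (negbTE evq).
apply: (@even_size_involution _ (nbr 0)) => // x xs.
- by have [] := nbrP 0 x q0 xs.
- have [ns Xn] := nbrP 0 x q0 xs; have [_ nall] := allnbr _ ns.
  have [|j jq xE] := nall x xs.
    by apply/eqP => nx; apply: (Xirr 0 x q0); rewrite {2}nx.
  have [_] := nbrP j _ jq ns; rewrite -xE => Xj.
  by rewrite {2}xE (Xeq 0 j (nbr 0 x) x q0 jq (Xsym _ _ _ q0 Xn) Xj).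
- have [_ Xn] := nbrP 0 x q0 xs.
  by apply/eqP => nx; apply: (Xirr 0 x q0); rewrite nx in Xn.
Qed.

(** * The equation that fails *)

Section MatchingEquation.
Variables (a q : nat).
Notation coord := 'I_a.+3.
Notation pos0 := (pos0 a).
Notation pos1 := (pos1 a).
Notation pos2 := (pos2 a).

(** The variables stand for the pieces R_j, for the relations saying that
coordinate 0 is entry number i of the list at coordinate 2, and for the set of
the tuples with a vertex at coordinate 0. *)
Definition piece j : term a.+3 := Var _ j.*2.+1.
Definition listed i : term a.+3 := Var _ i.*2.+2.
Definition vertex : term a.+3 := Var _ 0.

Definition matching_hyps : seq (equation a.+3) :=
  [:: (Cyl pos1 (piece 0), vertex);
      (Cyl pos2 vertex, vertex);
      (piece 0, Cyl pos2 (Minus (Cyl pos0 (meet vertex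
         (Minus (join_all [seq listed i | i <- iota 0 q.+1]))))))] ++
  [seq (meet (Cyl pos1 (listed i)) (Transp pos0 pos1 (Cyl pos1 (listed i))),
        Diag pos0 pos1) | i <- iota 0 q.+1] ++
  [seq (piece j, Transp pos0 pos1 (piece j)) | j <- iota 0 q] ++
  [seq (piece j,
        Minus (join_all (Diag pos0 pos1 :: [seq piece i | i <- iota 0 j])))
     | j <- iota 0 q] ++
  [seq (Cyl pos1 (piece 0), Cyl pos1 (piece j)) | j <- iota 0 q] ++
  [seq (Cyl pos1 (piece j), Cyl pos1 (piece 0)) | j <- iota 0 q].

Definition matching_equation := quasi_equation matching_hyps (piece 0).

(** What the inclusions [matching_hyps] say.  [mm_function] makes entry i of a
list unique: the exchange of the coordinates 0 and 1 provides the second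
candidate, at coordinate 1, without a fourth coordinate being needed. *)
Record matching_model (M : frame a.+3) (X F : nat -> set M) (V : set M) :
    Prop := MatchingModel {
  mm_vertex : cylindrify pos1 (X 0) `<=` V;
  mm_vertex_cyl : cylindrify pos2 V `<=` V;
  mm_list : forall m, X 0 m -> exists2 n, access pos2 m n &
    forall m', access pos0 n m' -> V m' -> exists2 i, i < q.+1 & F i m';
  mm_function : forall i m, i < q.+1 ->
    cylindrify pos1 (F i) m -> cylindrify pos1 (F i) (exchange pos0 pos1 m) ->
    diag pos0 pos1 m;
  mm_sym : forall j m, j < q -> X j m -> X j (exchange pos0 pos1 m);
  mm_irr : forall j m, j < q -> X j m -> ~ diag pos0 pos1 m;
  mm_disj : forall i j m, i < j -> j < q -> X i m -> ~ X j m;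
  mm_total : forall j, j < q ->
    cylindrify pos1 (X 0) `<=>` cylindrify pos1 (X j)
}.

Lemma matching_hypsP (M : frame a.+3) (v : nat -> set M) :
  all (models v) matching_hyps <->
  matching_model (fun j => v j.*2.+1) (fun i => v i.*2.+2) (v 0).
Proof.
(* Keeps simplification from unfolding the first element of this range. *)
have [js jsE] : exists js, js = iota 0 q.+1 by eexists.
rewrite /matching_hyps -jsE !all_cat !all_map /=; split.
  move=> /and5P[/and4P[/asboolP vx /asboolP vc /asboolP ls _]].
  move=> /allP fn /allP sy /allP di /andP[/allP t1 /allP t2].
  have iotaP n i : i < n -> i \in iota 0 n by move=> ?; rewrite mem_iota.
  split=> //.
  - move=> m /ls; rewrite [X in sem _ X]/= sem_cyl => -[n].
    rewrite sem_minus => nv mn.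
    exists n => // m' nm' vm'; apply: contrapT => no.
    apply: nv; rewrite sem_cyl; exists m' => //.
    apply/sem_meet; split=> // /sem_join_all[i].
    rewrite jsE size_map size_iota => iq.
    by rewrite (nth_map 0) ?size_iota // nth_iota // => Fi; apply: no; exists i.
  - move=> i m /iotaP; rewrite -jsE => /fn/asboolP fi cm cm'; apply: fi.
    by apply/sem_meet.
  - by move=> j m /iotaP/sy/asboolP; apply.
  - by move=> j m /iotaP/di/asboolP dj /dj nd dg; apply: nd; left.
  - move=> i j m ij /iotaP/di/asboolP dj xi /dj nd; apply: nd; right.
    apply/sem_join_all; exists i; first by rewrite size_map size_iota.
    by rewrite (nth_map 0) ?size_iota // nth_iota.
  - by move=> j jq; split; [exact/asboolP/t1/iotaP|exact/asboolP/t2/iotaP].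
move=> [vx vc ls fn sy ir di to].
have iotaP n i : i \in iota 0 n -> i < n by rewrite mem_iota.
apply/and5P; split.
- apply/and4P; split => //; apply/asboolP => // m /ls[n mn nl].
  rewrite [X in sem _ X]/= sem_cyl; exists n => //; rewrite sem_minus sem_cyl.
  move=> -[m' /sem_meet[vm']]; rewrite sem_minus => nj nm'; apply: nj.
  have [i iq Fi] := nl m' nm' vm'; apply/sem_join_all.
  exists i; first by rewrite jsE size_map size_iota.
  by rewrite jsE (nth_map 0) ?size_iota // nth_iota.
- apply/allP => i; rewrite jsE => /iotaP iq.
  apply/asboolP => m /sem_meet[c1 c2].
  exact: fn c1 c2.
- by apply/allP => j /iotaP jq; apply/asboolP => m; exact: sy.
- apply/allP => j /iotaP jq; apply/asboolP => m xj /= -[].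
    exact: ir xj.
  case/sem_join_all=> i; rewrite size_map size_iota => ij.
  rewrite (nth_map 0) ?size_iota // nth_iota // => xi.
  exact: di xi xj.
- by apply/andP; split; apply/allP => j /iotaP/to[t1 t2]; apply/asboolP.
Qed.

(** Fix [u] in X_0 and let the coordinates 0 and 1 vary: the X_j become binary
relations on the set S of the x that have an X_0-neighbour.  The list at
coordinate 2 of the tuple u' from [mm_list] contains all vertices, in particular
all of S. *)
Lemma no_matching_model_set_frame (U : Type)
    (X F : nat -> set (set_frame a.+3 U)) (V : set (set_frame a.+3 U)) :
  ~~ odd q -> 0 < q -> matching_model X F V -> forall u, ~ X 0 u.
Proof.
move=> evq q0 [vx vc ls fn sy ir di to] u Xu.
have [u' /= uu' lsu] := ls u Xu.
pose pair (w : set_frame a.+3 U) x y : set_frame a.+3 U :=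
  fun l => if l == pos0 then x else if l == pos1 then y else w l.
have pair_exchange w x y : exchange pos0 pos1 (pair w x y) = pair w y x.
  apply/funext => l; rewrite /pair /= /permute.
  by case: tpermP => [->|->|/eqP/negbTE-> /eqP/negbTE->].
have pair_access1 w x y y' : access pos1 (pair w x y) (pair w x y').
  by move=> l /eqP/negbTE l1; rewrite /pair l1.
have access1_pair w x y w' :
    access pos1 (pair w x y) w' -> w' = pair w x (w' pos1).
  move=> wl; apply/funext => l.
  have [->|l1] := eqVneq l pos1; first by [].
  by rewrite -wl; [rewrite /pair (negbTE l1)|exact/eqP].
have cyl1 Y w x y y' : Y (pair w x y) -> cylindrify pos1 Y (pair w x y').
  by exists (pair w x y).
apply: (@no_odd_matching_decomposition U q
  (fun x => exists y, X 0 (pair u x y))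
  (fun j x y => X j (pair u x y)) (fun i x => F i (pair u' x (u pos1)))) => //.
- exists (u pos0), (u pos1); suff <- : u = pair u (u pos0) (u pos1) by [].
  by apply/funext => l; rewrite /pair; do 2 case: eqP => [->//|_].
- move=> x [y Xxy]; apply: lsu.
    move=> l /eqP/negbTE l0; rewrite /pair l0; case: eqP => // ->.
    exact/esym/uu'.
  apply: vc; exists (pair u x (u pos1)); first by apply: vx; exact: cyl1 Xxy.
  by move=> l /uu' ul; rewrite /pair ul.
- move=> i x y iq Fx Fy; apply: (fn i (pair u' x y) iq); first exact: cyl1 Fx.
  by rewrite pair_exchange; exact: cyl1 Fy.
- move=> j x jq [y Xxy]; have [t1 t2] := to j jq.
  have [w Xw /access1_pair wE] := t1 _ (cyl1 _ u x y y Xxy).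
  exists (w pos1); last by rewrite -wE.
  have Xs : X j (pair u (w pos1) x).
    by rewrite -pair_exchange; apply: sy => //; rewrite -wE.
  have [w' Xw' /access1_pair w'E] := t2 _ (cyl1 _ _ _ _ x Xs).
  by exists (w' pos1); rewrite -w'E.
- by move=> j x y jq Xj; rewrite -pair_exchange; exact: sy.
- by move=> j x jq Xj; apply: (ir j (pair u x x) jq Xj).
- by move=> i j x y ij jq Xi; exact: di ij jq Xi.
Qed.

Lemma matching_equation_true : ~~ odd q -> 0 < q ->
  true_in_Pse matching_equation.
Proof.
move=> evq q0; apply: quasi_equation_true => U v /matching_hypsP mm u.
exact: no_matching_model_set_frame mm u.
Qed.

Definition matching_valuation (T : Type) (X F : nat -> T) (V : T) n : T :=
  if n is k.+1 then if odd k then F k./2 else X k./2 else V.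

Lemma matching_equation_refuted (M : frame a.+3) (X F : nat -> set M) V m :
  matching_model X F V -> X 0 m ->
  sem (matching_valuation X F V) matching_equation.1 <>
  sem (matching_valuation X F V) matching_equation.2.
Proof.
move=> mm X0m; apply: (@quasi_equation_refuted _ _ _ _ _ m) => //.
apply/matching_hypsP => /=.
have -> : (fun j => if odd j.*2 then F j.*2./2 else X j.*2./2) = X.
  by apply/funext => j; rewrite odd_double doubleK.
suff -> : (fun i => if ~~ odd i.*2 then F (uphalf i.*2)
                    else X (uphalf i.*2)) = F by [].
by apply/funext => i; rewrite odd_double uphalf_double.
Qed.

End MatchingEquation.

(** * The split frame *)

Section SplitFrame.
Variables (a k : nat).
Notation coord := 'I_a.+3.
Notation pos0 := (pos0 a).
Notation pos1 := (pos1 a).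
Notation pos2 := (pos2 a).
Notation vert := 'I_k.*2.+3.
Notation block := 'I_k.*2.+2.
Notation code := (block * 'I_k.+1)%type.

(** A filler carries a value modulo 2k + 2 and a value modulo k + 1, one for
each of the two moduli of the labels. *)
Inductive basept :=
| Vertex of vert
| Listing of {perm vert}
| Filler of coord & code.

Definition aut := ({perm vert} * (coord -> {perm code}))%type.
Implicit Types (phi psi : aut) (u w : coord -> basept).

Definition act phi x : basept :=
  match x with
  | Vertex x => Vertex (phi.1 x)
  | Listing p => Listing (p * phi.1)%g
  | Filler c z => Filler c (phi.2 c z)
  end.

Definition aut1 : aut := (1%g, fun=> 1%g).
Definition autV phi : aut := (phi.1^-1, fun c => (phi.2 c)^-1)%g.
Definition autM phi psi : aut := (phi.1 * psi.1, fun c => phi.2 c * psi.2 c)%g.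

Lemma act1 x : act aut1 x = x.
Proof. by case: x => [x|p|c z] /=; rewrite ?perm1 ?mulg1. Qed.

Lemma actM phi psi x : act (autM phi psi) x = act psi (act phi x).
Proof. by case: x => [x|p|c z] /=; rewrite ?permM ?mulgA. Qed.

Lemma actK phi : cancel (act phi) (act (autV phi)).
Proof. by case=> [x|p|c z] /=; rewrite ?permK ?mulgK. Qed.

Lemma actVK phi : cancel (act (autV phi)) (act phi).
Proof. by case=> [x|p|c z] /=; rewrite ?permKV ?mulgKV. Qed.

(** The tuples that get split are the coordinate permutations of these.  The
sort of a filler is its coordinate here, so that the coordinate permutation
determines the orbit. *)
Definition base_tuple x y (z : coord -> code) : coord -> basept :=
  fun l => if l == pos0 then Vertex x else
           if l == pos1 then Vertex y else Filler l (z l).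

Definition split_tuple u :=
  exists s : {perm coord}, exists x y z, x != y /\ u = base_tuple x y z \o s.

Lemma act_base_tuple phi x y z l :
  act phi (base_tuple x y z l) =
  base_tuple (phi.1 x) (phi.1 y) (fun c => phi.2 c (z c)) l.
Proof. by rewrite /base_tuple; do 2 case: eqP => // _. Qed.

Lemma split_tuple_act phi u : split_tuple u -> split_tuple (act phi \o u).
Proof.
move=> [s [x [y [z [xy ->]]]]].
exists s, (phi.1 x), (phi.1 y), (fun c => phi.2 c (z c)).
split; first by rewrite (inj_eq perm_inj).
by apply/funext => l /=; rewrite act_base_tuple.
Qed.

Lemma split_tuple_permute i j u : split_tuple u -> split_tuple (permute i j u).
Proof.
move=> [s [x [y [z [xy ->]]]]]; exists (tperm i j * s)%g, x, y, z; split=> //.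
by apply/funext => l; rewrite /permute /= permM.
Qed.

(** Two transpositions move any pair of distinct vertices to any other one. *)
Lemma base_tuple_orbit x y z x' y' z' : x != y -> x' != y' ->
  exists phi, forall l, base_tuple x' y' z' l = act phi (base_tuple x y z l).
Proof.
move=> xy xy'.
pose y1 := tperm x x' y.
have xy1 : y1 != x' by rewrite -(tpermL x x') (inj_eq perm_inj) eq_sym.
exists ((tperm x x' * tperm y1 y')%g, fun c => tperm (z c) (z' c)) => l.
rewrite act_base_tuple /= !permM tpermL -/y1 tpermL (tpermD xy1) 1?eq_sym //.
by rewrite /base_tuple; case: ifP => // _; case: ifP => // _; rewrite tpermL.
Qed.

(** Coordinates are compared up to an automorphism, and the cylindrifications
ignore the block: this is how every piece gets the same cylindrifications as
the whole. *)
Definition split_frame : frame a.+3 :=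
  @Frame a.+3 ((coord -> basept) * block)%type
    (fun i m m' => exists phi, forall l, l <> i -> m'.1 l = act phi (m.1 l))
    (fun i j m => (permute i j m.1, m.2)) (fun i j m => m.1 i = m.1 j).

(** The block matters only for the tuples that get split; blocks related by [R]
are not told apart. *)
Definition orbit_equiv (R : block -> block -> Prop) (m m' : split_frame) :=
  exists2 phi, m'.1 = act phi \o m.1 & split_tuple m.1 -> R m.2 m'.2.

Lemma orbit_equiv_congruence R : (forall j j', R j j' -> R j' j) ->
  congruence (orbit_equiv R).
Proof.
move=> Rsym; split.
- move=> m m' [phi mm' R12]; exists (autV phi).
    by apply/funext => l; rewrite mm' /= actK.
  move=> m's; apply/Rsym/R12.
  have -> : m.1 = act (autV phi) \o m'.1.
    by apply/funext => l; rewrite mm' /= actK.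
  exact: split_tuple_act.
- move=> i m m' n [phi mm' _] [psi mn]; exists (autM (autV phi) psi) => l li.
  by rewrite actM mm' /= actK mn.
- move=> i j m m' [phi mm' R12]; exists phi.
    by apply/funext => l /=; rewrite /permute mm'.
  move=> /= ms; apply: R12.
  have -> : m.1 = permute i j (permute i j m.1).
    by apply/funext => l; rewrite /permute tpermK.
  exact: split_tuple_permute.
- by move=> i j m m' [phi mm' _] /= mij; rewrite mm' /= mij.
Qed.

(** * Representations by labels *)

Section Labels.
Import GRing.Theory.
Local Open Scope ring_scope.
Variables (H : zmodType) (edge : coord -> coord -> vert -> vert -> H).
Variable (fill : code -> H).

Definition edge_weight i j x y : H :=
  match x, y with Vertex x, Vertex y => edge i j x y | _, _ => 0 end.

Definition fill_weight x : H := if x is Filler _ z then fill z else 0.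

Definition label u : H :=
  \sum_i \sum_j edge_weight i j (u i) (u j) + \sum_i fill_weight (u i).

Lemma sum_two (G : coord -> coord -> H) :
  (forall i j, (i, j) != (pos0, pos1) -> (i, j) != (pos1, pos0) -> G i j = 0) ->
  \sum_i \sum_j G i j = G pos0 pos1 + G pos1 pos0.
Proof.
move=> G0; rewrite pair_bigA /= (bigD1 (pos0, pos1)) //=.
rewrite (bigD1 (pos1, pos0)) //= big1 ?addr0 // => -[i j] /andP[? ?].
exact: G0.
Qed.

(** The contribution of the two vertices x, y at the positions i, j to the label
takes each value when one of them is fixed. *)
Definition edge_onto := forall i j x t, i != j ->
  exists2 y, x != y & edge i j x y + edge j i y x = t.

Hypothesis edge0 : forall i x, edge i i x x = 0.

(** Only the two vertex positions contribute to the double sum. *)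
Lemma label_base_tuple (s : {perm coord}) x y z :
  label (base_tuple x y z \o s) =
  edge (s^-1 pos0)%g (s^-1 pos1)%g x y + edge (s^-1 pos1)%g (s^-1 pos0)%g y x +
  \sum_l fill_weight (base_tuple x y z l).
Proof.
rewrite /label; congr (_ + _); last first.
  by rewrite [RHS](reindex_inj (@perm_inj _ s)).
rewrite (reindex_inj (@perm_inj _ s^-1%g)) /=.
under eq_bigr => i _ do rewrite (reindex_inj (@perm_inj _ s^-1%g)) /=.
under eq_bigr => i _ do under eq_bigr => j _ do rewrite !permKV.
rewrite sum_two // => i j; rewrite /base_tuple !xpair_eqE.
have [->|i0] := eqVneq i pos0; have [->|j0] := eqVneq j pos0 => //=.
- by case: (eqVneq j pos1).
- by case: (eqVneq i pos1).
- have [->|//] := eqVneq i pos1; have [->|//] := eqVneq j pos1.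
  by rewrite /= edge0.
Qed.

Lemma label_solve_fill (s : {perm coord}) x y z l t :
  (forall t, exists z, fill z = t) -> l != pos0 -> l != pos1 ->
  exists2 z', (forall c, c != l -> z' c = z c) &
    label (base_tuple x y z' \o s) = t.
Proof.
move=> fillS l0 l1.
pose r := edge (s^-1 pos0)%g (s^-1 pos1)%g x y +
  edge (s^-1 pos1)%g (s^-1 pos0)%g y x +
  \sum_(c | c != l) fill_weight (base_tuple x y z c).
have [zl zlE] := fillS (t - r).
exists (fun c => if c == l then zl else z c) => [c /negbTE->//|].
rewrite label_base_tuple (bigD1 l) //=.
rewrite {1}/base_tuple (negbTE l0) (negbTE l1) eqxx /= zlE.
under eq_bigr => c cl do rewrite /base_tuple (negbTE cl).
by rewrite addrCA subrK.
Qed.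

(** The label can be given any value by changing a single, prescribed coordinate
within the tuples that get split. *)
Lemma label_solve (s : {perm coord}) x y z l t :
  (forall t, exists z, fill z = t) -> edge_onto -> x != y ->
  exists x' y' z', [/\ x' != y',
    forall c, c != l -> base_tuple x' y' z' c = base_tuple x y z c &
    label (base_tuple x' y' z' \o s) = t].
Proof.
move=> fillS edgeS xy.
pose r := \sum_c fill_weight (base_tuple x y z c).
have fillE x' y' : \sum_c fill_weight (base_tuple x' y' z c) = r.
  by apply: eq_bigr => c _; rewrite /base_tuple; case: ifP => // _; case: ifP.
have s01 : s^-1%g pos0 != s^-1%g pos1 by rewrite (inj_eq perm_inj).
have [->|l0] := eqVneq l pos0.
  rewrite eq_sym in s01.
  have [x' yx' x'E] := edgeS _ _ y (t - r) s01.
  exists x', y, z; split; first by rewrite eq_sym.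
    by move=> c /negbTE c0; rewrite /base_tuple c0.
  by rewrite label_base_tuple fillE [X in X + _]addrC x'E subrK.
have [->|l1] := eqVneq l pos1.
  have [y' xy' y'E] := edgeS _ _ x (t - r) s01.
  exists x, y', z; split=> //.
    by move=> c /negbTE c1; rewrite /base_tuple c1.
  by rewrite label_base_tuple fillE y'E subrK.
have [z' z'z z'E] := label_solve_fill s x y z t fillS l0 l1.
exists x, y, z'; split=> // c cl.
by rewrite /base_tuple z'z.
Qed.

Lemma label_permute i j u : (forall i j i' j', edge i j = edge i' j') ->
  label (permute i j u) = label u.
Proof.
move=> edgeE; rewrite /label; congr (_ + _); last first.
  by rewrite [RHS](reindex_inj (@perm_inj _ (tperm i j))).
rewrite [RHS](reindex_inj (@perm_inj _ (tperm i j))) /=.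
apply: eq_bigr => l _; rewrite [RHS](reindex_inj (@perm_inj _ (tperm i j))) /=.
apply: eq_bigr => l' _; rewrite /permute.
by case: (u _) => // x; case: (u _) => // y /=; rewrite (edgeE _ _ l l').
Qed.

Variables (R : block -> block -> Prop) (rho : H -> block).
Hypothesis Rrefl : forall j, R j j.
Hypothesis rhoS : forall j, exists t, R (rho t) j.
Hypothesis fillS : forall t, exists z, fill z = t.

(** There may be fewer labels than blocks: [rho] only has to meet every class of
blocks. *)
Definition labelled (u : set_frame a.+3 basept) : split_frame :=
  (u, rho (label u)).

Lemma base_tuple_equiv s x y z x' y' z' j j' : x != y -> x' != y' -> R j j' ->
  orbit_equiv R (base_tuple x y z \o s, j) (base_tuple x' y' z' \o s, j').
Proof.
move=> xy xy' Rjj'; have [phi phiE] := base_tuple_orbit z z' xy xy'.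
by exists phi => //; apply/funext => l; rewrite /= phiE.
Qed.

Lemma unsplit_equiv u j j' : ~ split_tuple u -> orbit_equiv R (u, j) (u, j').
Proof. by move=> nu; exists aut1 => //; apply/funext => l; rewrite /= act1. Qed.

Lemma labelled_onto m : exists u, orbit_equiv R (labelled u) m.
Proof.
case: m => u j; have [[s [x [y [z [xy ->]]]]]|nu] := pselect (split_tuple u).
  have [t Rt] := rhoS j.
  have [//|//|z' _ z'E] := label_solve_fill s x y z (l := pos2) t fillS.
  by exists (base_tuple x y z' \o s); apply: base_tuple_equiv; rewrite ?z'E.
by exists u; exact: unsplit_equiv.
Qed.

(** The sum runs over all ordered pairs of coordinates, so that the label is
invariant under permutations of coordinates if [edge] ignores positions. *)
Lemma labelled_transp i j : (forall i j i' j', edge i j = edge i' j') ->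
  respects (orbit_equiv R) labelled (STransp i j).
Proof.
move=> edgeE u; rewrite /labelled /= label_permute //.
by exists aut1 => //; apply/funext => l; rewrite /= act1.
Qed.

Lemma labelled_cyl i : edge_onto ->
  respects (orbit_equiv R) labelled (SCyl i).
Proof.
move=> edgeS; split=> [u u' uu' | u [u1 j] [phi /= uu1]].
  by exists aut1 => l /uu'; rewrite /= act1.
pose u' := act (autV phi) \o u1.
have uu' l : l <> i -> u l = u' l.
  by move=> /uu1; rewrite /u' /= => ->; rewrite actK.
have [[s [x [y [z [xy u'E]]]]]|nu'] := pselect (split_tuple u'); last first.
  exists u' => //; exists phi => [|//].
  by apply/funext => l; rewrite /u' /= actVK.
have [t Rt] := rhoS j.
have [x' [y' [z' [xy' tupleE labE]]]] := label_solve s z (s i) t fillS edgeS xy.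
exists (base_tuple x' y' z' \o s).
  move=> l li; rewrite uu' // u'E /= tupleE // (inj_eq perm_inj); exact/eqP.
have [psi psiE] := base_tuple_orbit z' z xy' xy.
exists (autM psi phi); last by rewrite /= labE.
apply/funext => l; rewrite /= actM -psiE.
have -> : base_tuple x y z (s l) = u' l by rewrite u'E.
by rewrite /u' /= actVK.
Qed.

End Labels.

(** * Representation by clones *)

Section Clones.
Import GRing.Theory.
Local Open Scope ring_scope.

(** The second components of the clones determine the block.  Changing one clone
changes the block arbitrarily without affecting the tuple, but distinct clones
of one point make the diagonals incorrect. *)
Definition cloned (u : set_frame a.+3 (basept * block)) : split_frame :=
  (fst \o u, \sum_l (u l).2).

Lemma cloned_onto m :
  exists u : set_frame a.+3 (basept * block), orbit_equiv eq (cloned u) m.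
Proof.
case: m => u j; exists (fun l => (u l, if l == pos0 then j else 0)).
exists aut1 => [|_]; first by apply/funext => l; rewrite /= act1.
by rewrite /= -big_mkcond big_pred1_eq.
Qed.

Lemma cloned_transp i j : respects (orbit_equiv eq) cloned (STransp i j).
Proof.
move=> u; exists aut1 => [|_]; first by apply/funext => l; rewrite /= act1.
by rewrite /= [RHS](reindex_inj (@perm_inj _ (tperm i j))).
Qed.

Lemma cloned_cyl i : respects (orbit_equiv eq) cloned (SCyl i).
Proof.
split=> [u u' uu' | u [u1 j] [phi /= uu1]].
  by exists aut1 => l /uu'; rewrite /= act1 => ->.
exists (fun l => if l == i then
    (act (autV phi) (u1 i), j - \sum_(l' | l' != i) (u l').2) else u l).
  by move=> l /eqP/negbTE->.
exists phi => [|_] /=.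
  apply/funext => l /=; case: eqP => [->|/uu1->]; last by [].
  by rewrite actVK.
rewrite (bigD1 i) //= eqxx.
rewrite -[RHS](subrK (\sum_(l' | l' != i) (u l').2)); congr (_ + _).
by apply: eq_bigr => l /negbTE->.
Qed.

End Clones.

(** * Differences of vertices as labels *)

Section Differences.
Import GRing.Theory.
Local Open Scope ring_scope.
Variable n : nat.

(** The difference of two vertices modulo 2k + 3, shifted to start at 0, and
replaced by 0 when it exceeds [n]. *)
Definition gap (x y : vert) : 'I_n.+1 := inord (nat_of_ord (y - x)).-1.

Lemma gap_same x : gap x x = 0.
Proof. by rewrite /gap subrr; exact: (inord_val (0 : 'I_n.+1)). Qed.

Lemma gap_shift x (t : 'I_n.+1) : (t < k.*2.+2)%N ->
  gap x (x + inord t.+1) = t.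
Proof.
move=> tk; rewrite /gap [_ - x]addrC addKr inordK ?ltnS //=.
exact: inord_val.
Qed.

Lemma gap_unshift x (t : 'I_n.+1) : (t < k.*2.+2)%N ->
  gap (x - inord t.+1) x = t.
Proof.
by move=> tk; rewrite -[in RHS](gap_shift (x - inord t.+1) tk) subrK.
Qed.

Lemma shift_neq (x : vert) (t : nat) : (t < k.*2.+2)%N -> x != x + inord t.+1.
Proof.
move=> tk; rewrite eq_sym -subr_eq0 addrC addKr.
by apply/eqP => /(congr1 val); rewrite /= inordK.
Qed.

End Differences.

(** One of y - x and x - y is at most k + 1 and the other is larger, so that
only one of the two gaps counts: their sum is symmetric in x and y. *)
Lemma gap_onto : edge_onto (fun _ _ => gap k).
Proof.
move=> _ _ x t _.
have tk : t < k.*2.+2.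
  by rewrite (leq_trans (ltn_ord t)) // ltnS -addnn (leq_trans (leq_addr k k)).
exists (x + inord t.+1)%R; first exact: shift_neq.
rewrite gap_shift // -[RHS]GRing.addr0; congr (_ + _)%R.
have oppE : nat_of_ord (x - (x + inord t.+1))%R = k.*2.+2 - t.
  rewrite GRing.opprD GRing.addrA GRing.subrr GRing.add0r /= inordK ?ltnS //.
  by rewrite subSS modn_small // ltnS leq_subr.
apply/val_inj; rewrite /gap /inord val_insubd oppE ifN // -leqNgt.
by move: (ltn_ord t); lia.
Qed.

(** Counting only the pairs of positions in increasing order gives every
difference its own block, at the price of symmetry. *)
Definition ordered_gap (i j : coord) x y : block :=
  if i < j then gap k.*2.+1 x y else 0%R.

Lemma ordered_gap_same i x : ordered_gap i i x x = 0%R.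
Proof. by rewrite /ordered_gap ltnn. Qed.

Lemma ordered_gap_onto : edge_onto ordered_gap.
Proof.
move=> i j x t; rewrite /ordered_gap neq_ltn => /orP[] ij;
  rewrite ij ltnNge (ltnW ij) /=.
  exists (x + inord t.+1)%R; first exact: shift_neq.
  by rewrite GRing.addr0 gap_shift.
exists (x - inord t.+1)%R; last by rewrite GRing.add0r gap_unshift.
by rewrite eq_sym -{2}(GRing.subrK (inord t.+1)%R x) shift_neq.
Qed.

(** * Equations that hold in the split frame *)

Lemma valid_without_transp (e : equation a.+3) : true_in_Pse e ->
  (forall i j, ~ occurs (STransp i j) e) -> valid (orbit_equiv eq) e.
Proof.
move=> etrue noT v.
apply: (@sem_eq_of_representation _ _ (orbit_equiv eq) _ _
  (labelled ordered_gap fst id)) => //.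
- exact: orbit_equiv_congruence.
- apply: labelled_onto => //; [exact: ordered_gap_same|by move=> j; exists j|].
  by move=> t; exists (t, ord0).
case=> // [i _|i j /noT //].
apply: labelled_cyl => //; [exact: ordered_gap_same|by move=> j; exists j| |].
  by move=> t; exists (t, ord0).
exact: ordered_gap_onto.
Qed.

Lemma valid_without_diag (e : equation a.+3) : true_in_Pse e ->
  (forall i j, ~ occurs (SDiag i j) e) -> valid (orbit_equiv eq) e.
Proof.
move=> etrue noD v.
apply: (@sem_eq_of_representation _ _ (orbit_equiv eq) _ _ cloned) => //.
- exact: orbit_equiv_congruence.
- exact: cloned_onto.
case=> // [i _|i j _|i j /noD //].
- exact: cloned_cyl.
- exact: cloned_transp.
Qed.

Lemma valid_without_cyl (e : equation a.+3) : true_in_Pse e ->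
  (forall i, ~ occurs (SCyl i) e) -> valid (orbit_equiv eq) e.
Proof.
move=> etrue noC v.
apply: (@sem_eq_of_representation _ _ (orbit_equiv eq) _ _
  (labelled (fun _ _ _ _ => 0%R) fst id)) => //.
- exact: orbit_equiv_congruence.
- apply: labelled_onto => //; first by move=> j; exists j.
  by move=> t; exists (t, ord0).
case=> // [i /noC //|i j _].
exact: labelled_transp.
Qed.

(** The value 0 is a harmless default for the indices that name no value of
[sig]. *)
Lemma block_representatives (B : finType) (sig : block -> B) : #|B| <= k ->
  exists rho : 'I_k.+1 -> block, forall j, exists t, sig (rho t) = sig j.
Proof.
move=> Bk.
exists (fun t => odflt ord0 [pick j | enum_rank (sig j) == t :> nat]) => j.
exists (inord (enum_rank (sig j))).
rewrite inordK; last by rewrite ltnS (leq_trans _ Bk) // ltnW.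
case: pickP => [j' /eqP jj'|/(_ j)]; last by rewrite eqxx.
exact/enum_rank_inj/val_inj.
Qed.

(** For a given valuation, a block matters only through the orbits of split
tuples, one for each coordinate permutation, on which it belongs to the values
of the variables.  There are few such signatures, independently of the number
of blocks, and blocks with the same signature are merged. *)
Lemma valid_few_vars n (e : equation a.+3) : true_in_Pse e ->
  size (vars e) <= n -> #|{ffun 'I_n * {perm coord} -> bool}| <= k ->
  valid (orbit_equiv eq) e.
Proof.
move=> etrue en Bk v vsat.
pose sig j := [ffun p : 'I_n * {perm coord} =>
  `[< exists x y z, x != y /\
      v (nth 0 (vars e) p.1) (base_tuple x y z \o p.2, j) >]].
have [rho rhoS] := block_representatives sig Bk.
pose R j j' := sig j = sig j'.
apply: (@sem_eq_of_representation _ _ (orbit_equiv R) _ _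
  (labelled (fun _ _ => gap k) snd rho)) => //.
- by apply: orbit_equiv_congruence => j j'; rewrite /R.
- apply: labelled_onto => //; first by move=> _ x; exact: gap_same.
  by move=> t; exists (ord0, t).
- case=> // [i _|i j _]; last exact: labelled_transp.
  apply: labelled_cyl => //; first by move=> _ x; exact: gap_same.
    by move=> t; exists (ord0, t).
  exact: gap_onto.
move=> x xe m m' [phi m'E mR] xm.
have [[s [b [c [z [bc mE]]]]]|nm] := pselect (split_tuple m.1); last first.
  by apply: (vsat x xe m) => //; exists phi.
have xn : index x (vars e) < n by rewrite (leq_trans _ en) // index_mem.
have : sig m.2 (Ordinal xn, s).
  rewrite ffunE; apply/asboolP; exists b, c, z; split=> //=.
  by rewrite nth_index // -mE; case: (m) xm.
rewrite mR; last by exists s, b, c, z.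
rewrite ffunE => /asboolP[b' [c' [z' [bc']]]] /=; rewrite nth_index //.
apply: vsat => //; case: m' m'E {mR} => u' j' /= ->.
have -> : act phi \o m.1 =
    base_tuple (phi.1 b) (phi.1 c) (fun c => phi.2 c (z c)) \o s.
  by rewrite mE; apply/funext => l /=; rewrite act_base_tuple.
by apply: base_tuple_equiv; rewrite ?(inj_eq perm_inj).
Qed.

(** * Failure of the matching equation in the split frame *)

Definition split_piece j : set split_frame :=
  [set m : split_frame | m.2 = j :> nat /\
    exists x y z, x != y /\ m.1 = base_tuple x y z].
Definition split_listed i : set split_frame :=
  [set m : split_frame | exists p (i' : vert),
     [/\ i' = i :> nat, m.1 pos2 = Listing p & m.1 pos0 = Vertex (p i')]].
Definition split_vertex : set split_frame :=
  [set m : split_frame | exists x, m.1 pos0 = Vertex x].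

Lemma act_vertex phi x y : act phi x = Vertex y -> exists x', x = Vertex x'.
Proof. by case: x => //= x _; exists x. Qed.

Lemma act_listing phi x p : act phi x = Listing p ->
  exists2 p', x = Listing p' & p = (p' * phi.1)%g.
Proof. by case: x => //= p' [<-]; exists p'. Qed.

(** Automorphisms move enumerations along with vertices, and so preserve the
relation of being entry number i. *)
Lemma cyl_split_listed i m :
  cylindrify pos1 (split_listed i) m -> split_listed i m.
Proof.
case=> m' [p [i' [i'E m'2 m'0]]] [phi mm'].
move: m'2 m'0; rewrite !mm' // => /act_listing[p' mp' ->].
case mx: (m.1 pos0) => [x||] //= [xp].
exists p', i'; split=> //; rewrite mx; congr Vertex.
by apply: (@perm_inj _ phi.1); rewrite xp permM.
Qed.

Lemma split_matching_model :
  matching_model k.*2.+2 split_piece split_listed split_vertex.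
Proof.
split.
- move=> m [m' [_ [x [y [z [_ m'E]]]]] [phi mm']].
  by apply: (act_vertex (phi := phi) (y := x)); rewrite -mm' // m'E.
- move=> m [m' [x m'x] [phi mm']].
  by apply: (act_vertex (phi := phi) (y := x)); rewrite -mm'.
- move=> m [_ [x [y [z [xy mE]]]]].
  (* The identity enumeration lists all vertices. *)
  exists (fun l => if l == pos2 then Listing 1%g else m.1 l, m.2).
    by exists aut1 => l /eqP/negbTE /= ->; rewrite act1.
  move=> m' [phi mm'] [v m'v]; have m'2 := mm' pos2.
  exists ((phi.1^-1)%g v); first exact: ltn_ord.
  exists phi.1, ((phi.1^-1)%g v); split=> //.
    by rewrite m'2 //= mul1g.
  by rewrite m'v permKV.
- move=> i m _ /cyl_split_listed[p [x [xi m2 m0]]].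
  move=> /cyl_split_listed[p' [x' [x'i]]] /=; rewrite /permute tpermL tpermD //.
  rewrite m2 => -[pE] ->; rewrite m0 pE; congr (Vertex (p' _)).
  by apply: val_inj; rewrite /= xi x'i.
- move=> j m _ [mj [x [y [z [xy mE]]]]]; split=> //; exists y, x, z.
  split; first by rewrite eq_sym.
  apply/funext => l; rewrite /= mE /permute /base_tuple.
  by case: tpermP => [->|->|/eqP/negbTE-> /eqP/negbTE->].
- move=> j m _ [_ [x [y [z [xy mE]]]]] /=; rewrite mE /base_tuple /= => -[xyE].
  by rewrite xyE eqxx in xy.
- move=> i j m ij _ [mi _] [mj _].
  by rewrite -mi -mj ltnn in ij.
- move=> j jq; split=> m [m' [_ m'P] mm'].
    by exists (m'.1, Ordinal jq).
  by exists (m'.1, ord0).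
Qed.

Lemma split_saturated n :
  saturated (orbit_equiv eq)
    (matching_valuation split_piece split_listed split_vertex n).
Proof.
have satX j : saturated (orbit_equiv eq) (split_piece j).
  move=> m m' [phi m'E mm'] [mj [x [y [z [xy mE]]]]]; split.
    rewrite -mm' // mE; exists 1%g, x, y, z; split=> //.
    by apply/funext => l; rewrite /= perm1.
  exists (phi.1 x), (phi.1 y), (fun c => phi.2 c (z c)).
  rewrite (inj_eq perm_inj); split=> //.
  by apply/funext => l; rewrite m'E mE /= act_base_tuple.
have satF i : saturated (orbit_equiv eq) (split_listed i).
  move=> m m' [phi m'E _] [p [i' [i'i m2 m0]]].
  by exists (p * phi.1)%g, i'; rewrite m'E /= m2 m0 permM.
rewrite /matching_valuation; case: n => [|n]; last by case: ifP.
by move=> m m' [phi m'E _] [x mx]; exists (phi.1 x); rewrite m'E /= mx.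
Qed.

Lemma matching_equation_fails :
  exists2 v : nat -> set split_frame,
    forall n, saturated (orbit_equiv eq) (v n) &
    sem v (matching_equation a k.*2.+2).1 <>
    sem v (matching_equation a k.*2.+2).2.
Proof.
exists (matching_valuation split_piece split_listed split_vertex).
  exact: split_saturated.
pose u := base_tuple ord0 (inord 1) (fun=> (ord0, ord0)).
have := matching_equation_refuted (m := (u, ord0) : split_frame)
  split_matching_model.
apply.
split=> //; exists ord0, (inord 1), (fun=> (ord0, ord0)); split=> //.
by rewrite -val_eqE /= inordK.
Qed.

End SplitFrame.

Theorem theorem2 (alpha : nat) (alpha_ge3 : 3 <= alpha)
    (E : set (equation alpha)) (axE : equational_axiom_set E) :
  exists e : nat -> equation alpha, forall n : nat,
    E (e n) /\
    n < size (vars (e n)) /\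
    (exists i j : 'I_alpha, occurs (STransp i j) (e n)) /\
    (exists k l : 'I_alpha, occurs (SDiag k l) (e n)) /\
    (exists m : 'I_alpha, occurs (SCyl m) (e n)).
Proof.
case: alpha alpha_ge3 E axE => [|[|[|a]]] // _ E [Etrue Ecomplete].
suff /choice[e eP] : forall n, exists e, E e /\ n < size (vars e) /\
    (exists i j, occurs (STransp i j) e) /\
    (exists k l, occurs (SDiag k l) e) /\ (exists m, occurs (SCyl m) e).
  by exists e.
move=> n; apply: contrapT => no_axiom.
(* The number of signatures of blocks with respect to n variables. *)
pose k := #|{ffun 'I_n * {perm 'I_a.+3} -> bool}|.
have Evalid e : E e -> valid (orbit_equiv (k := k) eq) e.
  move=> Ee; have etrue := Etrue e Ee.
  have [en|en] := leqP (size (vars e)) n.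
    exact: valid_few_vars etrue en _.
  have [hasT|noT] := pselect (exists i j, occurs (STransp i j) e); last first.
    by apply: valid_without_transp => // i j ij; apply: noT; exists i, j.
  have [hasD|noD] := pselect (exists i j, occurs (SDiag i j) e); last first.
    by apply: valid_without_diag => // i j ij; apply: noD; exists i, j.
  have [hasC|noC] := pselect (exists i, occurs (SCyl i) e); last first.
    by apply: valid_without_cyl => // i ei; apply: noC; exists i.
  by case: no_axiom; exists e.
have [v vsat] := matching_equation_fails a k; apply.
have eqC : congruence (orbit_equiv (a := a) (k := k) eq).
  exact: orbit_equiv_congruence.
apply: (derivable_sound eqC Evalid) vsat.
by apply/Ecomplete/matching_equation_true; rewrite //= negbK odd_double.
Qed.
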